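(* For every integer $m\ge 1$, the number of vertices of the digraph $\mathcal D^*_m$ is $$|V(\mathcal D^*_m)|=\begin{cases}2^m,&\text{if } m \text{ is even},\\ 2^m-1,&\text{if } m\text{ is odd}.\end{cases}$$
   Context: Let $\mathcal D_{ud}$ be the digraph on $\{a,b,c,d,e,f\}$ with arcs from each of $a,b,d$ to each of $b,c,f$, and from each of $c,e,f$ to each of $a,d,e$. $V(\mathcal D_m)$ is the set of words $\alpha_1\cdots\alpha_m$ over $\{a,b,c,d,e,f\}$ with $\alpha_1\in\{a,d,e\}$, $\alpha_m\in\{c,e,f\}$ and each $(\alpha_i,\alpha_{i+1})$, $1\le i\le m-1$, an arc of $\mathcal D_{ud}$. The outlet word of $\alpha=\alpha_1\cdots\alpha_m\in V(\mathcal D_m)$ is the binary word $o(\alpha)=o_1\cdots o_m$ with $o_j=0$ if $\alpha_j\in\{b,d,f\}$ and $o_j=1$ if $\alpha_j\in\{a,c,e\}$. The vertex set of $\mathcal D^*_m$ is $V(\mathcal D^*_m)=\{o(\alpha):\alpha\in V(\mathcal D_m)\}$. *)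

(* Defs.v *)
From HB Require Import structures.
From mathcomp Require Import all_boot.

Set Implicit Arguments.
Unset Strict Implicit.
Unset Printing Implicit Defensive.

Inductive letter : predArgType := La | Lb | Lc | Ld | Le | Lf.

Definition letter_code (x : letter) : 'I_6 :=
  match x with
  | La => @Ordinal 6 0 isT
  | Lb => @Ordinal 6 1 isT
  | Lc => @Ordinal 6 2 isT
  | Ld => @Ordinal 6 3 isT
  | Le => @Ordinal 6 4 isT
  | Lf => @Ordinal 6 5 isT
  end.

Definition letter_decode (i : 'I_6) : letter :=
  nth La [:: La; Lb; Lc; Ld; Le; Lf] i.

Lemma letter_codeK : cancel letter_code letter_decode.
Proof. by case. Qed.

HB.instance Definition _ := Finite.copy letter (can_type letter_codeK).

Definition arc_ud : rel letter := fun x y =>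
  ((x \in [:: La; Lb; Ld]) && (y \in [:: Lb; Lc; Lf]))
  || ((x \in [:: Lc; Le; Lf]) && (y \in [:: La; Ld; Le])).

(* The empty word is excluded: it has neither a first nor a last letter. *)
Definition is_vertex_word (s : seq letter) : bool :=
  if s is x :: p then
    [&& x \in [:: La; Ld; Le], last x p \in [:: Lc; Le; Lf] & path arc_ud x p]
  else false.

Definition V_D (m : nat) : {set m.-tuple letter} :=
  [set w : m.-tuple letter | is_vertex_word w].

(* Binary digits are booleans: [false] is 0 and [true] is 1. *)
Definition outlet_digit (x : letter) : bool :=
  match x with
  | Lb | Ld | Lf => false
  | La | Lc | Le => true
  end.

Definition outlet_word (m : nat) (w : m.-tuple letter) : m.-tuple bool :=
  [tuple of map outlet_digit w].

Definition V_Dstar (m : nat) : {set m.-tuple bool} :=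
  [set outlet_word w | w in V_D m].

(* Main.v *)
Require Import Defs.
From mathcomp Require Import all_boot.

(** The map [outlet_digit] is read as a labelling of the digraph, so that outlet
    words are the words accepted by a nondeterministic automaton.  Its state
    only records whether the last letter is closed, i.e. in [c, e, f]: arcs out
    of a letter and the final condition depend on nothing else, and the
    condition on the first letter says that the automaton starts closed.

    A digit equal to the state (1 when closed, 0 when open) may lead to either
    state, whereas a digit different from it forces the state to flip
    ([arc_digit_closed]).  Once a digit agrees with the state, both states are
    available, and the rest of the word can be read so as to end closed: the two
    states are never both stuck on the same word, because being stuck forces the
    parity of the length.  Hence a word is rejected only when every digit
    differs from the current state and the final state is open
    ([lift_outletP]).  From the initial closed state this is the alternating
    word 0101...0, which has odd length.  So no word is missed in even length
    and exactly one in odd length. *)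

Definition closed_letter (x : letter) := x \in [:: Lc; Le; Lf].

(** From state [c], a word fails exactly when each digit differs from the state
    it meets (so that the state flips every time) and the last state is open;
    the two conjuncts express these in closed form. *)
Definition stuck (c : bool) (s : seq bool) :=
  (s == traject negb (~~ c) (size s)) && (odd (size s) == c).

Lemma stuck_cons c b s : stuck c (b :: s) = (b != c) && stuck (~~ c) s.
Proof.
rewrite /stuck /= eqseq_cons -andbA.
by case: b; case: c; case: (odd (size s)).
Qed.

(** Being stuck from [c] makes [c] the parity of the length, so the opposite
    state is always safe. *)
Lemma stuck_parity s : ~~ stuck (~~ odd (size s)) s.
Proof. by rewrite /stuck; case: odd; rewrite andbF. Qed.

Lemma arc_digit_closed x b d :
  (exists y, [/\ arc_ud x y, outlet_digit y = b & closed_letter y = d])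
  <-> (b == closed_letter x) || (d != closed_letter x).
Proof.
split=> [[y [+ <- <-]]|ok]; first by case: x; case: y.
(* Only a digit equal to the state leaves two candidates, told apart by [d];
   for the other digit the successor is forced, with the flipped state. *)
pose y := if closed_letter x then
            if b then (if d then Le else La) else Ld
          else if b then Lc else (if d then Lf else Lb).
by exists y; rewrite /y; case: x ok {y}; case: b; case: d.
Qed.

(** A digit equal to the state leaves a free choice of
    the next state, resolved by [stuck_parity]; the other digit has a forced
    next state, to which the induction hypothesis applies. *)
Lemma lift_outletP x s :
  (exists p, [/\ path arc_ud x p, map outlet_digit p = s
               & closed_letter (last x p)])
  <-> ~~ stuck (closed_letter x) s.
Proof.
elim: s x => [|b s IHs] x.
  rewrite /stuck /=; split; first by case=> -[|y p] [] //= _ _ ->.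
  by move=> cx; exists [::]; split=> //=; case: closed_letter cx.
rewrite stuck_cons negb_and negbK; split.
  case=> -[|y p] [] //= /andP[xy yp] [yb ps] cl.
  have /arc_digit_closed : exists z, [/\ arc_ud x z, outlet_digit z = b
      & closed_letter z = closed_letter y] by exists y.
  case/orP=> [-> //|yx]; have <- : closed_letter y = ~~ closed_letter x.
    by case: closed_letter yx; case: closed_letter.
  by apply/orP; right; apply/IHs; exists p.
move=> ok; have [d [bd ds]] : exists d,
    (b == closed_letter x) || (d != closed_letter x) /\ ~~ stuck d s.
  case/orP: ok => [-> | ns].
    by exists (~~ odd (size s)); rewrite stuck_parity.
  by exists (~~ closed_letter x); split=> //; case: closed_letter; rewrite orbT.
have [y [xy yb yd]] := (arc_digit_closed x b d).2 bd.
rewrite -yd in ds; have [p [yp ps cl]] := (IHs y).2 ds.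
by exists (y :: p); rewrite /= xy yp yb ps.
Qed.

(** The letters allowed in first position are those that may follow a closed
    letter, so [c] serves as a virtual predecessor of the whole word. *)
Lemma is_vertex_wordE w : w != [::] ->
  is_vertex_word w = path arc_ud Lc w && closed_letter (last Lc w).
Proof.
case: w => // x p _; rewrite /= [_ && path _ _ _]andbC andbA.
by congr (_ && _ && _); case: x.
Qed.

Lemma V_DstarE m : 0 < m -> V_Dstar m = [set s | ~~ stuck true (val s)].
Proof.
move=> m_gt0; have nz (w : m.-tuple letter) : tval w != [::].
  by rewrite -size_eq0 size_tuple -lt0n.
apply/setP=> s; rewrite inE; apply/imsetP/idP.
  case=> w; rewrite inE is_vertex_wordE ?nz // => /andP[wp wc] ->.
  by apply/(lift_outletP Lc); exists w.
move/(lift_outletP Lc)=> [p [wp ps wc]].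
have sz_p : size p == m by rewrite -(size_map outlet_digit) ps size_tuple.
exists (Tuple sz_p); last exact/val_inj/esym.
by rewrite inE is_vertex_wordE ?nz //= wp.
Qed.

Lemma card_stuck m : #|[set s : m.-tuple bool | stuck true (val s)]| = odd m.
Proof.
have sz : size (traject negb false m) == m by rewrite size_traject.
case: (boolP (odd m)) => m_odd.
  apply/eqP/cards1P; exists (Tuple sz).
  by apply/setP=> s; rewrite !inE /stuck size_tuple m_odd andbT.
apply/eqP; rewrite cards_eq0; apply/eqP/setP=> s.
by rewrite !inE /stuck size_tuple (negPf m_odd) andbF.
Qed.

Theorem theorem3p10 (m : nat) (hm : 1 <= m) :
  #|V_Dstar m| = if odd m then 2 ^ m - 1 else 2 ^ m.
Proof.
rewrite V_DstarE //.
have -> : [set s : m.-tuple bool | ~~ stuck true (val s)] =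
    ~: [set s : m.-tuple bool | stuck true (val s)].
  by apply/setP=> s; rewrite !inE.
by rewrite cardsCs setCK card_stuck card_tuple card_bool; case: odd; rewrite ?subn0.
Qed.
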